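(* Let $p,q\ge 3$ be primes with $p\ne q$. Then the groups $G_p$ and $G_q$ are not isomorphic.
   Context: For a prime $p\ge 3$ let $[p]=\{0,\dots,p-1\}$, let $[p]^*$ be the free monoid on $[p]$, viewed as a $p$-regular rooted tree, and let $\mathrm{Aut}([p]^* )$ be the group of bijections of $[p]^*$ preserving the prefix relation (in both directions). Define $g_p,h_p\in\mathrm{Aut}([p]^* )$ recursively as follows: both fix the empty word, and for $i\in[p]$, $w\in[p]^*$ (with $i+1$ taken modulo $p$), \[ g_p(0w)=1\,g_p(w),\qquad g_p(iw)=(i+1)w \ \text{ for } i\ne 0, \] \[ h_p(1w)=2\,h_p(w),\qquad h_p(iw)=(i+1)w \ \text{ for } i\ne 1. \] (In wreath recursion notation, with $c$ the cycle $(0\,1\,\dots\,p-1)$: $g_p=c(g_p,1,\dots,1)$ and $h_p=c(1,h_p,1,\dots,1)$.) Set $G_p:=\langle g_p,h_p\rangle\le\mathrm{Aut}([p]^* )$. *)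

(* Defs.v *)
From HB Require Import structures.
From mathcomp Require Import all_boot.
From mathcomp Require Import boolp.

Set Implicit Arguments.
Unset Strict Implicit.
Unset Printing Implicit Defensive.

Local Open Scope group_scope.

(* Automorphisms of the p-regular rooted tree whose vertices are the words    *)
(* over 'I_p.                                                                 *)
Record treeAut (p : nat) := TreeAut {
  treeAut_fun :> seq 'I_p -> seq 'I_p;
  treeAut_bij : bijective treeAut_fun;
  treeAut_prefix : forall u v : seq 'I_p,
    prefix (treeAut_fun u) (treeAut_fun v) = prefix u v }.

Lemma treeAutP (p : nat) (x y : treeAut p) : x =1 y -> x = y.
Proof.
case: x y => [f fb fp] [g gb gp] /= /funext fg; move: fb fp gb gp.
by rewrite fg => fb fp gb gp; congr TreeAut; exact: Prop_irrelevance.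
Qed.

HB.instance Definition _ (p : nat) := gen_eqMixin (treeAut p).
HB.instance Definition _ (p : nat) := gen_choiceMixin (treeAut p).

Section TreeAutGroup.
Variable p : nat.
Implicit Types x y z : treeAut p.

Definition treeAut_one : treeAut p :=
  @TreeAut p id (inv_bij (frefl id)) (fun _ _ => erefl).

Fact treeAut_mul_prefix x y (u v : seq 'I_p) :
  prefix (x (y u)) (x (y v)) = prefix u v.
Proof. by rewrite !treeAut_prefix. Qed.

Definition treeAut_mul x y : treeAut p :=
  TreeAut (bij_comp (treeAut_bij x) (treeAut_bij y))
          (treeAut_mul_prefix x y).

Fact treeAut_inv_sig x : {g | cancel x g & cancel g x}.
Proof. by apply: cid2; case: (treeAut_bij x) => g fg gf; exists g. Qed.

Definition treeAut_inv_fun x : seq 'I_p -> seq 'I_p := s2val (treeAut_inv_sig x).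

Fact treeAut_inv_bij x : bijective (treeAut_inv_fun x).
Proof.
rewrite /treeAut_inv_fun; case: (treeAut_inv_sig x) => g fg gf /=.
by exists x.
Qed.

Fact treeAut_inv_prefix x (u v : seq 'I_p) :
  prefix (treeAut_inv_fun x u) (treeAut_inv_fun x v) = prefix u v.
Proof.
rewrite /treeAut_inv_fun; case: (treeAut_inv_sig x) => g fg gf /=.
by rewrite -(treeAut_prefix x) !gf.
Qed.

Definition treeAut_inv x : treeAut p :=
  TreeAut (treeAut_inv_bij x) (treeAut_inv_prefix x).

Fact treeAut_mulA : associative treeAut_mul.
Proof. by move=> x y z; exact: treeAutP. Qed.

Fact treeAut_mul1 : left_id treeAut_one treeAut_mul.
Proof. by move=> x; exact: treeAutP. Qed.

Fact treeAut_mulr1 : right_id treeAut_one treeAut_mul.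
Proof. by move=> x; exact: treeAutP. Qed.

Fact treeAut_mulV : left_inverse treeAut_one treeAut_inv treeAut_mul.
Proof.
move=> x; apply: treeAutP => w /=.
by rewrite /treeAut_inv_fun; case: (treeAut_inv_sig x).
Qed.

Fact treeAut_mulrV : right_inverse treeAut_one treeAut_inv treeAut_mul.
Proof.
move=> x; apply: treeAutP => w /=.
by rewrite /treeAut_inv_fun; case: (treeAut_inv_sig x).
Qed.

HB.instance Definition _ := isGroup.Build (treeAut p)
  treeAut_mulA treeAut_mul1 treeAut_mulr1 treeAut_mulV treeAut_mulrV.

End TreeAutGroup.

Section Generated.
Variables (G : groupType) (S : {pred G}).

(* The subgroup generated by S, as the intersection of the subgroups of G     *)
(* containing S.                                                              *)
Definition generated : {pred G} := fun x =>
  `[< forall H : {pred G}, group_closed H -> {subset S <= H} -> x \in H >].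

Fact generated_closed : group_closed generated.
Proof.
split; first by apply/asboolP => H [].
move=> x y /asboolP xG /asboolP yG; apply/asboolP => H HG SH.
by case: (HG) => _; apply; [exact: xG | exact: yG].
Qed.

Definition generated_group := {x : G | x \in generated}.

HB.instance Definition _ := SubChoice.on generated_group.
HB.instance Definition _ :=
  SubChoice_isSubGroup.Build G generated generated_group generated_closed.

End Generated.

Definition isomorphic (G H : groupType) : Prop :=
  exists f : {multiplicative G -> H}, bijective f.

(* The wreath recursion t = c(1, ..., t, ..., 1) with t at position k and c   *)
(* the cyclic shift ordS (i |-> i + 1 mod p).                                 *)
Fixpoint shift_fun (p k : nat) (w : seq 'I_p) : seq 'I_p :=
  if w is i :: w' then
    ordS i :: (if i == k :> nat then shift_fun k w' else w')
  else [::].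

Fixpoint unshift_fun (p k : nat) (w : seq 'I_p) : seq 'I_p :=
  if w is i :: w' then
    ord_pred i :: (if ord_pred i == k :> nat then unshift_fun k w' else w')
  else [::].

Fact shift_bij (p k : nat) : bijective (@shift_fun p k).
Proof.
exists (@unshift_fun p k); elim=> [//|i w IHw]; cbn [shift_fun unshift_fun].
  by rewrite ordSK; case: eqP => _; rewrite ?IHw.
by rewrite ord_predK; case: eqP => _; rewrite ?IHw.
Qed.

Fact shift_prefix (p k : nat) (u v : seq 'I_p) :
  prefix (shift_fun k u) (shift_fun k v) = prefix u v.
Proof.
elim: u v => [|i u IHu] [|j v] //=.
rewrite (inj_eq (@ordS_inj p)); case: eqP => //= <-.
by case: ifP.
Qed.

Definition shift (p k : nat) : treeAut p :=
  TreeAut (shift_bij p k) (@shift_prefix p k).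

Definition g_ (p : nat) : treeAut p := shift p 0.
Definition h_ (p : nat) : treeAut p := shift p 1.

Definition G_ (p : nat) : groupType := generated_group (pred2 (g_ p) (h_ p)).

(* Main.v *)
Require Import Defs.
From HB Require Import structures.
From mathcomp Require Import all_boot all_algebra ring.
From mathcomp Require Import boolp.

Set Implicit Arguments.
Unset Strict Implicit.
Unset Printing Implicit Defensive.

Import GRing.Theory.
Local Open Scope group_scope.

(** Write G' and G'' for the first two derived subgroups of G. The invariant
separating the groups is the following property of an integer n:
<<
  (star_n)   [y, x ^ n] lies in G'' for all x in G and all y in G'.
>>
It only depends on the isomorphism class of G, and the theorem follows from
two facts about G = G_p.

If p >= 5, then (star_p) holds. The element x ^ p fixes the first level of the
tree, and so does y; hence [y, x ^ p] fixes the first level and its sections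
are commutators of elements of G. It therefore suffices that G'' contains every
automorphism acting as an element of G' below one vertex of the first level and
trivially elsewhere ([derived_realizes]). Let a = g h^-1. It fixes the
first level, with sections g at 1, h^-1 at 2 and 1 elsewhere; conjugating by
powers of g gives translates a_0, a_1, a_2, a_3 of this pattern. The elements
a_0 a_1^-1 and a_2 a_3^-1 of G' are supported at {1, 2, 3} and {3, 4, 5}, and
because p >= 5 these sets of residues meet only in 3, where the sections are h
and g. So the commutator of the two elements is in G'' and acts as [h, g] below
3 alone. The automorphisms of this kind obtained below 3 form a normal subgroup
of G, so they comprise all of G', and conjugation by g moves them to the other
vertices.

If p is an odd prime, then (star_n) forces p to divide n. For x in G
and a vertex j of the first level, [weight x j] is a residue mod p computed from
the action of x on the first three levels; it is the value, at the section of x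
at j, of the homomorphism G -> Z/p with g |-> 2 and h |-> 0. The map
x |-> (weight x, rotation of x at the root) is a homomorphism to the metabelian
group (Z/p)^p : Z/p, so [weight] vanishes on G''. On [[g, h], g ^ n] it does not
vanish unless p divides n ([G2_dvd]).

For distinct odd primes p and q, one of them, say q, is at least 5. An
isomorphism carries (star_q) from G_q to G_p, so that p divides q. *)

(** * Derived subgroups *)

(** P is a mere predicate, so that the definition can be iterated and compared
across groups without packing subgroup structures. *)
Inductive derived (T : groupType) (P : T -> Prop) : T -> Prop :=
| derived1 : derived P 1
| derivedR x y : P x -> P y -> derived P [~ x, y]
| derivedM x y : derived P x -> derived P y -> derived P (x * y)
| derivedV x : derived P x -> derived P x^-1.

Fact morph_monoid (T U : groupType) (f : T -> U) :
  {morph f : x y / x * y} -> (f 1 = 1) * {morph f : x y / x * y}.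
Proof.
by move=> fM; split=> //; apply: (@mulIg _ (f 1)); rewrite -fM !mul1g.
Qed.

(** A magma morphism between groups, equipped with the structure that the
theory of group morphisms expects. *)
Definition group_morph (T U : groupType) (f : T -> U)
    (fM : {morph f : x y / x * y}) : UMagmaMorphism.type T U :=
  HB.pack f (isUMagmaMorphism.Build T U f (morph_monoid fM)).

Lemma derived_morph (T U : groupType) (f : UMagmaMorphism.type T U)
    (P : T -> Prop) (Q : U -> Prop) :
  (forall x, P x -> Q (f x)) -> forall x, derived P x -> derived Q (f x).
Proof.
move=> PQ x; elim=> {x} [|x y Px Py|x y _ IHx _ IHy|x _ IHx].
- by rewrite gmulf1; exact: derived1.
- by rewrite gmulfR; apply: derivedR; exact: PQ.
- by rewrite gmulfM; exact: derivedM.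
- by rewrite gmulfV; exact: derivedV.
Qed.

(** Used for the inclusion of G into the full automorphism group of the tree:
its derived subgroups can be computed on either side. *)
Lemma derived_lift (T U : groupType) (f : UMagmaMorphism.type T U)
    (P : T -> Prop) (Q : U -> Prop) :
    (forall y, Q y -> exists2 x, P x & f x = y) ->
  forall y, derived Q y -> exists2 x, derived P x & f x = y.
Proof.
move=> QP y; elim=> {y} [|y z /QP[x Px <-] /QP[t Pt <-]|
    y z _ [x Px <-] _ [t Pt <-]|y _ [x Px <-]].
- by exists 1; [exact: derived1 | rewrite gmulf1].
- by exists [~ x, t]; [exact: derivedR | rewrite gmulfR].
- by exists (x * t); [exact: derivedM | rewrite gmulfM].
- by exists x^-1; [exact: derivedV | rewrite gmulfV].
Qed.

Lemma derivedJ (T : groupType) (P : T -> Prop) (z : T) :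
    (forall x, P x -> P (x ^ z)) ->
  forall x, derived P x -> derived P (x ^ z).
Proof.
move=> PJ x; elim=> {x} [|x y Px Py|x y _ IHx _ IHy|x _ IHx].
- by rewrite conj1g; exact: derived1.
- by rewrite conjRg; apply: derivedR; exact: PJ.
- by rewrite conjMg; exact: derivedM.
- by rewrite conjVg; exact: derivedV.
Qed.

Definition second_derived (T : groupType) : T -> Prop :=
  derived (derived (fun=> True)).

(** * The group generated by g and h *)

Definition inG (p : nat) (x : treeAut p) : Prop :=
  x \in generated (pred2 (g_ p) (h_ p)).

Lemma inG_ind (p : nat) (P : treeAut p -> Prop) :
    P 1 -> (forall x y, P x -> P y -> P (x * y)) ->
    (forall x, P x -> P x^-1) -> P (g_ p) -> P (h_ p) ->
  forall x, inG x -> P x.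
Proof.
move=> P1 PM PV Pg Ph x /asboolP/(_ (fun y => `[< P y >])) H.
apply/asboolP; apply: H.
  split=> [|y z /asboolP Py /asboolP Pz]; apply/asboolP => //.
  by apply: PM => //; exact: PV.
by move=> y; rewrite !inE => /orP[] /eqP->; apply/asboolP.
Qed.

Lemma inG1 p : inG (1 : treeAut p).
Proof. exact: (generated_closed _).1. Qed.

Lemma inGM p (x y : treeAut p) : inG x -> inG y -> inG (x * y).
Proof. exact: (group_closedM (generated_closed _)). Qed.

Lemma inGV p (x : treeAut p) : inG x -> inG x^-1.
Proof. exact: (group_closedV (generated_closed _)). Qed.

Lemma inGR p (x y : treeAut p) : inG x -> inG y -> inG [~ x, y].
Proof. by move=> Gx Gy; do ![apply: inGM | apply: inGV | done]. Qed.

Lemma inG_g p : inG (g_ p).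
Proof. by apply/asboolP => H _; apply; rewrite !inE eqxx. Qed.

Lemma inG_h p : inG (h_ p).
Proof. by apply/asboolP => H _; apply; rewrite !inE eqxx orbT. Qed.

Lemma derived_inG p (x : treeAut p) : derived (@inG p) x -> inG x.
Proof.
by elim=> {x} [|x y|x y _ + _|x _]; [exact: inG1|exact: inGR|exact: inGM|exact: inGV].
Qed.

(** Modulo K the generators commute, so the quotient is abelian. *)
Lemma derived_sub_normal p (K : treeAut p -> Prop) :
    K 1 -> (forall x y, K x -> K y -> K (x * y)) -> (forall x, K x -> K x^-1) ->
    (forall x z, K x -> inG z -> K (x ^ z)) -> K [~ h_ p, g_ p] ->
  forall x, derived (@inG p) x -> K x.
Proof.
move=> K1 KM KV KJ Khg.
(* For fixed y, the elements commuting with y modulo K form a subgroup. *)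
have KR y : inG y -> K [~ g_ p, y] -> K [~ h_ p, y] ->
    forall x, inG x -> K [~ x, y].
  move=> Gy Kg Kh x Gx.
  suff: inG x /\ K [~ x, y] by case.
  move: x Gx; apply: inG_ind => [|x z [Gx Kx] [Gz Kz]|x [Gx Kx]||] //.
  - by split; [exact: inG1 | rewrite comm1g].
  - split; first exact: inGM.
    have -> : [~ x * z, y] = [~ x, y] ^ z * [~ z, y].
      by rewrite !commgEl !conjgE !invgM !mulgA !mulgK.
    by apply: KM => //; exact: KJ.
  - split; first exact: inGV.
    have -> : [~ x^-1, y] = ([~ x, y]^-1) ^ x^-1.
      by rewrite invgR !commgEl !conjgE !invgK !mulgA !mulgK.
    by apply: KJ; [exact: KV | exact: inGV].
  - by split; first exact: inG_g.
  - by split; first exact: inG_h.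
have Kg x : inG x -> K [~ x, g_ p].
  by apply: KR => //; [exact: inG_g | rewrite commgg].
have Kh x : inG x -> K [~ x, h_ p].
  apply: KR; first exact: inG_h; last by rewrite commgg.
  by rewrite -invgR; exact: KV.
move=> x; elim=> {x} [|x y Gx Gy|x y _ + _|x _] //.
- by apply: KR => //; rewrite -invgR; apply: KV; [exact: Kg | exact: Kh].
- exact: KM.
- exact: KV.
Qed.

(** * Sections at the first level *)

Section Sections.
Variable m : nat.
Local Notation I := 'I_m.+3.
Local Notation A := (treeAut m.+3).
Implicit Types (x y : A) (i j : I) (s t : I -> A).

Lemma treeAutM x y w : (x * y) w = x (y w). Proof. by []. Qed.
Lemma treeAutKV x w : x (x^-1 w) = w.
Proof. by rewrite -treeAutM mulgV. Qed.
Lemma treeAutK x w : x^-1 (x w) = w.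
Proof. by rewrite -treeAutM mulVg. Qed.

Lemma treeAut_nil x : x [::] = [::].
Proof.
have := treeAut_prefix x [::] (x^-1 [::]); rewrite treeAutKV prefix0s.
by case: (x [::]).
Qed.

(** In wreath recursion notation, x = c^k (s 0, ..., s (p - 1)); the first level
is identified with Z/p, so that c is the translation by 1. *)
Definition acts x k s := forall i w, x (i :: w) = (i + k)%R :: s i w.

Lemma acts_ext x k s t : acts x k s -> s =1 t -> acts x k t.
Proof. by move=> ax st i w; rewrite ax st. Qed.

Lemma acts_inj x y k s : acts x k s -> acts y k s -> x = y.
Proof.
by move=> ax ay; apply: treeAutP => -[|i w]; rewrite ?treeAut_nil // ax ay.
Qed.

Lemma acts1 : acts 1 0%R (fun=> 1).
Proof. by move=> i w; rewrite addr0. Qed.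

Lemma actsM x y k l s t : acts x k s -> acts y l t ->
  acts (x * y) (l + k)%R (fun i => s (i + l)%R * t i).
Proof. by move=> ax ay i w; rewrite !treeAutM ay ax addrA. Qed.

Lemma actsV x k s : acts x k s -> acts x^-1 (- k)%R (fun i => (s (i - k)%R)^-1).
Proof.
by move=> ax i w; apply: (can_inj (treeAutK x)); rewrite treeAutKV ax treeAutKV subrK.
Qed.

Lemma acts_stabM x y s t : acts x 0%R s -> acts y 0%R t ->
  acts (x * y) 0%R (fun i => s i * t i).
Proof.
move=> ax ay; have := actsM ax ay; rewrite addr0 => /acts_ext; apply=> i.
by rewrite addr0.
Qed.

Lemma acts_stabV x s : acts x 0%R s -> acts x^-1 0%R (fun i => (s i)^-1).
Proof.
by move=> ax; have := actsV ax; rewrite oppr0 => /acts_ext; apply=> i; rewrite addr0.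
Qed.

Lemma acts_stabR x y s t : acts x 0%R s -> acts y 0%R t ->
  acts [~ x, y] 0%R (fun i => [~ s i, t i]).
Proof.
by move=> ax ay; do ![apply: acts_stabM | apply: acts_stabV | done].
Qed.

(** Conjugation by x translates the sections of d by the rotation of x, and
conjugates them by the sections of x. *)
Lemma acts_stabJV x k s d t : acts x k s -> acts d 0%R t ->
  acts (d ^ x^-1) 0%R (fun i => t (i - k)%R ^ (s (i - k)%R)^-1).
Proof.
move=> ax ad; have := actsM (actsV (actsV ax)) (actsM ad (actsV ax)).
rewrite -conjgE opprK addr0 addNr => /acts_ext; apply=> i.
by rewrite addrK conjgE.
Qed.

Definition selfsim x := exists k s, acts x k s /\ forall i, inG (s i).

Lemma natr_ord0 : (m.+3%:R = 0 :> I)%R.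
Proof. by rewrite Zp_nat; apply: val_inj; exact: modnn. Qed.

Lemma val_natr n : n < m.+3 -> (n%:R%R : I) = n :> nat.
Proof. by move=> n_lt; rewrite /= Zp_nat /= modn_small. Qed.

Lemma eq_natr n k : n < m.+3 -> k < m.+3 -> (n%:R == k%:R :> I)%R = (n == k).
Proof. by move=> nlt klt; rewrite -(inj_eq val_inj) /= !val_natr. Qed.

Lemma ordS_add1 i : ordS i = (i + 1)%R.
Proof. by apply: val_inj; rewrite /= modnDmr addn1. Qed.

Lemma acts_shift k : k < m.+3 ->
  acts (shift m.+3 k) 1%R (fun i => if i == k%:R%R then shift m.+3 k else 1).
Proof.
move=> k_lt i w; rewrite [LHS]/= ordS_add1.
by rewrite -(inj_eq val_inj i) /= val_natr //; case: ifP.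
Qed.

Lemma inG_selfsim x : inG x -> selfsim x.
Proof.
move: x; apply: inG_ind => [|x y [k [s [ax Gs]]] [l [t [ay Gt]]]|x [k [s [ax Gs]]]||].
- by exists 0%R, (fun=> 1); split; [exact: acts1 | move=> _; exact: inG1].
- by exists (l + k)%R; eexists; split; [exact: actsM ax ay | move=> i; exact: inGM].
- by exists (- k)%R; eexists; split; [exact: actsV ax | move=> i; exact: inGV].
- eexists; eexists; split; first exact: (acts_shift (ltn0Sn _)).
  by move=> i /=; case: ifP => _; [exact: inG_g | exact: inG1].
- eexists; eexists; split; first exact: (acts_shift (isT : 1 < m.+3)).
  by move=> i /=; case: ifP => _; [exact: inG_h | exact: inG1].
Qed.

Lemma derived_stab y : derived (@inG m.+3) y ->
  exists s, acts y 0%R s /\ forall i, inG (s i).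
Proof.
elim=> {y} [|x y|x y _ [s [ax Gs]] _ [t [ay Gt]]|x _ [s [ax Gs]]].
- by exists (fun=> 1); split; [exact: acts1 | move=> _; exact: inG1].
- move=> /inG_selfsim[k [s [ax Gs]]] /inG_selfsim[l [t [ay Gt]]].
  have := actsM (actsV ax) (actsM (actsV ay) (actsM ax ay)).
  rewrite -commgEl.
  have -> : (l + k - l - k = 0)%R by ring.
  move=> a; eexists; split; first exact: a.
  by move=> i; do ![apply: inGM | apply: inGV | done].
- by eexists; split; [exact: acts_stabM ax ay | move=> i; exact: inGM].
- by eexists; split; [exact: acts_stabV ax | move=> i; exact: inGV].
Qed.

Lemma pow_stab x : inG x -> exists s, acts (x ^+ m.+3) 0%R s /\ forall i, inG (s i).
Proof.
move=> /inG_selfsim[k [s [ax Gs]]].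
have H n : exists t, acts (x ^+ n) (k *+ n)%R t /\ forall i, inG (t i).
  elim: n => [|n [t [at_ Gt]]].
    by exists (fun=> 1); split; [exact: acts1 | move=> _; exact: inG1].
  rewrite expgS mulrSr addrC.
  eexists; split; first by rewrite addrC; exact: actsM ax at_.
  by move=> i; exact: inGM.
have [t] := H m.+3; rewrite -mulr_natr natr_ord0.
by rewrite mulr0 => ?; exists t.
Qed.

End Sections.

(** * Automorphisms supported below one vertex *)

Section Branch.
Variable m : nat.
Local Notation I := 'I_m.+3.
Local Notation A := (treeAut m.+3).
Local Notation G1 := (derived (@inG m.+3)).
Local Notation G2 := (derived G1).
Implicit Types (x y : A) (i j : I) (s t : I -> A).

Definition delta (i0 : I) (z : A) : I -> A := fun i => if i == i0 then z else 1.

Definition realizes i z := exists2 d, G2 d & acts d 0%R (delta i z).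

Lemma derivedGJ (P : A -> Prop) :
    (forall x z, inG z -> P x -> P (x ^ z)) ->
  forall x z, inG z -> derived P x -> derived P (x ^ z).
Proof. by move=> PJ x z Gz; apply: derivedJ => y; exact: PJ. Qed.

Lemma G1J x z : inG z -> G1 x -> G1 (x ^ z).
Proof.
apply: derivedGJ => y t Gt Gy; rewrite conjgE.
by do ![apply: inGM | apply: inGV | done].
Qed.

Lemma G2J x z : inG z -> G2 x -> G2 (x ^ z).
Proof. by apply: derivedGJ; exact: G1J. Qed.

(** Conjugation by g moves the support from i to i + 1. It also conjugates the
section by a section of g, which is harmless because G' is normal. *)
Lemma realizes_succ i : (forall z, G1 z -> realizes i z) ->
  forall z, G1 z -> realizes (i + 1)%R z.
Proof.
move=> Hi z Gz.
have ag := @acts_shift m 0 (ltn0Sn _).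
set s := (fun i : I => _) in ag.
have Gs j : inG (s j) by rewrite /s; case: ifP => _; [exact: inG_g | exact: inG1].
have [d Gd ad] := Hi (z ^ s i) (G1J (Gs i) Gz).
exists (d ^ (g_ m.+3)^-1); first by apply: G2J => //; apply/inGV/inG_g.
have := acts_stabJV ag ad => /acts_ext; apply=> j; rewrite /delta subr_eq.
by case: eqP => [->|_]; rewrite ?addrK ?conjgK // conj1g.
Qed.

Lemma realizes_all i0 : (forall z, G1 z -> realizes i0 z) ->
  forall i z, G1 z -> realizes i z.
Proof.
move=> H0 i; rewrite -(subrK i0 i) addrC -(natr_Zp (i - i0)%R).
elim: (nat_of_ord _) => [|n IHn]; first by rewrite addr0.
by rewrite mulrSr addrA; exact: realizes_succ.
Qed.

(** Such an x is the product of the automorphisms that act as x below one vertex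
and trivially elsewhere. *)
Lemma stab_sections_G2 : (forall i z, G1 z -> realizes i z) ->
  forall x s, acts x 0%R s -> (forall i, G1 (s i)) -> G2 x.
Proof.
move=> H x s ax Gs.
have [d Gd ad] : exists2 d, G2 d &
    acts d 0%R (fun i => if i \in enum I then s i else 1).
  elim: (enum I) (enum_uniq I) => [|i r IHr] /=.
    by exists 1; [exact: derived1 | exact: acts1].
  move=> /andP[ir /IHr[d Gd ad]]; have [e Ge ae] := H i _ (Gs i).
  exists (e * d); first exact: derivedM.
  have := acts_stabM ae ad => /acts_ext; apply=> j; rewrite /delta inE.
  by case: eqP => [->|_] /=; rewrite ?(negbTE ir) ?mulg1 ?mul1g.
suff -> : x = d by [].
by apply: acts_inj ax _; apply: acts_ext ad _ => i; rewrite mem_enum.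
Qed.

(** Both y and x ^ p fix the first level, with sections in G; the sections of
their commutator are then in G'. *)
Lemma commutator_pow_G2 : (forall i z, G1 z -> realizes i z) ->
  forall x y, inG x -> G1 y -> G2 [~ y, x ^+ m.+3].
Proof.
move=> H x y /pow_stab[s [ax Gs]] /derived_stab[t [ay Gt]].
apply: (stab_sections_G2 H (acts_stabR ay ax)) => i; exact: derivedR.
Qed.

End Branch.

(** * Realizing the derived subgroup below one vertex *)

Section AtLeastFive.
Variable m : nat.
Local Notation p := m.+2.+3.
Local Notation I := 'I_p.
Local Notation A := (treeAut p).
Local Notation G1 := (derived (@inG p)).
Local Notation G2 := (derived G1).
Implicit Types (x y : A) (i j : I) (s t : I -> A).

(** The sections of a = g h^-1. *)
Definition spine (i : I) : A :=
  if i == 1%:R%R then g_ p else if i == 2%:R%R then (h_ p)^-1 else 1.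

Lemma acts_gVh : acts (g_ p * (h_ p)^-1) 0%R spine.
Proof.
have := actsM (acts_shift (ltn0Sn _)) (actsV (acts_shift (isT : 1 < p))).
rewrite addNr => /acts_ext; apply=> i; rewrite /spine.
rewrite !subr_eq -!mulrSr.
case: eqP => [->|_]; last by rewrite mul1g; case: ifP => // _; rewrite invg1.
by rewrite eq_natr // invg1 mulg1.
Qed.

(** The translate a_k of a by k. *)
Definition spine_conj k := (g_ p * (h_ p)^-1) ^ (g_ p)^-1 ^+ k.

(** The section of g at 0 would conjugate a nontrivial section of the translate.
For k <= 3 the support of a_(k - 1) avoids 0, as 4 < p; so it is merely
translated. *)
Lemma acts_spine_conj k : k <= 3 -> 
  acts (spine_conj k) 0%R (fun i => spine (i - k%:R)%R).
Proof.
elim: k => [_|k IHk k_lt].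
  rewrite /spine_conj expg0 conjg1; apply: acts_ext acts_gVh _ => i.
  by rewrite subr0.
rewrite /spine_conj expgSr conjgM.
have := acts_stabJV (acts_shift (ltn0Sn _)) (IHk (ltnW k_lt)).
move/acts_ext; apply=> i /=.
rewrite -addrA -opprD -mulrS; case: eqP => [i1|_]; last by rewrite invg1 conjg1.
have -> : spine (i - k.+1%:R)%R = 1; last by rewrite conj1g.
rewrite mulrS opprD addrA i1 /spine !subr_eq -!natrD.
by rewrite -[X in (X == _)%R](mulr0n 1) !eq_natr //; case: k k_lt {IHk i1} => [|[|[|]]].
Qed.

Lemma inG_spine_conj k : inG (spine_conj k).
Proof.
rewrite /spine_conj conjgE; set u := _ ^+ k.
have Gu : inG u.
  rewrite /u; elim: k {u} => [|k IHk]; first exact: inG1.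
  by rewrite expgS; apply: inGM => //; apply/inGV/inG_g.
have Ga : inG (g_ p * (h_ p)^-1).
  by apply: inGM; [exact: inG_g | exact/inGV/inG_h].
by do ![exact: Ga | apply: inGM | apply: inGV | done].
Qed.

(** The element a_k a_(k + 1)^-1 is a commutator, since a_(k + 1) is a conjugate
of a_k. *)
Lemma spine_conj_div k : G1 (spine_conj k * (spine_conj k.+1)^-1).
Proof.
rewrite {2}/spine_conj expgSr conjgM -/(spine_conj k) -conjVg.
rewrite -[X in X * _]invgK -commgEl.
by apply: derivedR; [exact/inGV/inG_spine_conj | exact/inGV/inG_g].
Qed.

Lemma spine_natr n : n < p ->
  spine n%:R%R = if n == 1%N then g_ p else if n == 2 then (h_ p)^-1 else 1.
Proof. by move=> n_lt; rewrite /spine !eq_natr. Qed.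

Lemma spine_natrB n k : k <= n < p -> spine (n%:R - k%:R)%R =
  if n - k == 1%N then g_ p else if n - k == 2 then (h_ p)^-1 else 1.
Proof.
case/andP=> kn n_lt; rewrite -natrB // spine_natr //.
exact: leq_ltn_trans (leq_subr _ _) n_lt.
Qed.

(** The case n = p serves the vertex 5 when p = 5, where it is the vertex 0. *)
Lemma spine_out n : 2 < n <= p -> spine n%:R%R = 1.
Proof.
case/andP=> n3; rewrite leq_eqVlt => /orP[/eqP->|n_lt].
  by rewrite natr_ord0 -[0%R]/(0%:R)%R spine_natr.
by rewrite spine_natr //; case: n n3 n_lt => [|[|[|]]].
Qed.

(** At vertex 3, the elements z that are realized form a subgroup. It is normal
because every element of G is the section at 3 of some c in G fixing the first
level: a_2 has section g there, and a_1 has section h^-1. *)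
Lemma derived_realizes i z : G1 z -> realizes i z.
Proof.
move: i z; apply: (@realizes_all _ 3%:R%R).
apply: derived_sub_normal => [|x y [d Gd ad] [e Ge ae]|x [d Gd ad]|x z [d Gd ad] Gz|].
- exists 1; first exact: derived1.
  by apply: acts_ext (@acts1 _) _ => i; rewrite /delta; case: ifP.
- exists (d * e); first exact: derivedM.
  apply: acts_ext (acts_stabM ad ae) _ => i.
  by rewrite /delta; case: ifP => // _; rewrite mulg1.
- exists d^-1; first exact: derivedV.
  apply: acts_ext (acts_stabV ad) _ => i.
  by rewrite /delta; case: ifP => // _; rewrite invg1.
- suff [c [s [Gc ac sz]]] : exists c s, [/\ inG c, acts c 0%R s & s 3%:R%R = z].
    exists (d ^ c); first exact: G2J.
    have := acts_stabM (acts_stabV ac) (acts_stabM ad ac).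
    move/acts_ext; apply=> i; rewrite -conjgE /delta.
    by case: eqP => [->|_]; rewrite ?sz // conj1g.
  move: z Gz; apply: inG_ind => [|z t [c [s [Gc ac sz]]] [e [r [Ge ae rt]]]|z [c [s [Gc ac sz]]]||].
  + by exists 1, (fun=> 1); split; [exact: inG1 | exact: acts1 |].
  + exists (c * e); eexists; split; [exact: inGM|exact: acts_stabM ac ae|].
    by rewrite /= sz rt.
  + exists c^-1; eexists; split; [exact: inGV|exact: acts_stabV ac|].
    by rewrite /= sz.
  + exists (spine_conj 2); eexists; split.
    * exact: inG_spine_conj.
    * exact: acts_spine_conj.
    * by rewrite /= spine_natrB.
  + exists (spine_conj 1)^-1; eexists; split.
    * exact/inGV/inG_spine_conj.
    * exact/acts_stabV/acts_spine_conj.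
    * by rewrite /= spine_natrB //= invgK.
(* The two entries have supports {1, 2, 3} and {3, 4, 5}, which share only 3. *)
- exists [~ spine_conj 0 * (spine_conj 1)^-1, spine_conj 2 * (spine_conj 3)^-1].
    by apply: derivedR; exact: spine_conj_div.
  have a k (k3 : k < 3) :=
    acts_stabM (acts_spine_conj (ltnW k3)) (acts_stabV (acts_spine_conj k3)).
  apply: acts_ext (acts_stabR (a 0 isT) (a 2 isT)) _ => i; rewrite /delta.
  case: eqP => [->|i3].
    by rewrite !spine_natrB //= mul1g invg1 mulg1 invgK.
  have [i4|i4] := eqVneq i 4%:R%R.
    by rewrite i4 !spine_natrB //= invg1 mulg1 comm1g.
  have [i5|i5] := eqVneq i 5%:R%R.
    rewrite i5 subr0 spine_out // -natrB // spine_out //.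
    by rewrite invg1 mulg1 comm1g.
  rewrite /spine !subr_eq -!natrD (negbTE i4) (negbTE i5).
  by move/eqP/negbTE: i3 => ->; rewrite invg1 mulg1 commg1.
Qed.

End AtLeastFive.

(** * A metabelian quotient from the first three levels *)

Section Labels.
Variable m : nat.
Local Notation p := m.+3.
Local Notation I := 'I_p.
Local Notation A := (treeAut p).
Local Notation G1 := (derived (@inG p)).
Local Notation G2 := (derived G1).
Implicit Types (x y : A) (i j : I) (v : seq I).

(** The rotation by which x acts on the children of v; [rotates] says that x acts
there by a rotation, and then 0 is as good a test letter as any other. *)
Definition label x v : I := last 0%R (x (rcons v 0%R)).

Definition rotates x := forall v i, x (rcons v i) = rcons (x v) (i + label x v)%R.

(** In a word for x, each letter g or h adds 1 to the label at the root and 1 to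
exactly one label of the first level, and each inverse letter subtracts 1 in the
same way. The sections of x are again given by words, whence the equality at
every vertex. *)
Definition balanced x := forall v, (\sum_i label x (rcons v i) = label x v)%R.

Lemma label1 v : label 1 v = 0%R.
Proof. exact: last_rcons. Qed.

Lemma labelM x y v : rotates x -> rotates y ->
  (label (x * y)%g v = label y v + label x (y v))%R.
Proof.
by move=> rx ry; rewrite {1}/label treeAutM ry rx last_rcons add0r.
Qed.

Lemma rotatesM x y : rotates x -> rotates y -> rotates (x * y).
Proof.
by move=> rx ry v i; rewrite labelM // !treeAutM ry rx addrA.
Qed.

Lemma rcons_rotV x v i : rotates x ->
  x^-1 (rcons v i) = rcons (x^-1 v) (i - label x (x^-1 v)%g)%R.
Proof.
by move=> rx; apply: (can_inj (treeAutK x)); rewrite treeAutKV rx treeAutKV subrK.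
Qed.

Lemma labelV x v : rotates x -> (label (x^-1)%g v = - label x (x^-1 v)%g)%R.
Proof. by move=> rx; rewrite /label rcons_rotV // last_rcons sub0r. Qed.

Lemma rotatesV x : rotates x -> rotates x^-1.
Proof. by move=> rx v i; rewrite labelV // rcons_rotV. Qed.

Lemma balancedM x y : rotates x -> rotates y -> balanced x -> balanced y ->
  balanced (x * y).
Proof.
move=> rx ry bx by_ v; rewrite labelM // -by_ -bx.
rewrite [X in (_ + X)%R](reindex_inj (addIr (label y v))) -big_split /=.
by apply: eq_bigr => i _; rewrite labelM // ry.
Qed.

Lemma balancedV x : rotates x -> balanced x -> balanced x^-1.
Proof.
move=> rx bx v; rewrite labelV // -bx -sumrN.
rewrite [RHS](reindex_inj (addIr (- label x (x^-1 v)%g)%R)) /=.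
by apply: eq_bigr => i _; rewrite labelV // rcons_rotV.
Qed.

Lemma shift_nil k : label (shift p k) [::] = 1%R.
Proof. by rewrite /label /=; case: ifP => _; rewrite /= ordS_add1 add0r. Qed.

Lemma shift_cons k i v : label (shift p k) (i :: v) =
  if i == k :> nat then label (shift p k) v else 0%R.
Proof.
rewrite /label /=; case: ifP => _; last by rewrite last_rcons.
by case: v.
Qed.

Lemma rotates_shift k : rotates (shift p k).
Proof.
elim=> [|j v IHv] i; first by rewrite shift_nil /= ordS_add1; case: ifP.
rewrite shift_cons /=; case: ifP => _; last by rewrite addr0.
by have /= -> := IHv i.
Qed.

Lemma balanced_shift k : k < p -> balanced (shift p k).
Proof.
move=> k_lt; elim=> [|j v IHv].
  rewrite shift_nil (bigD1 (Ordinal k_lt)) //= shift_cons eqxx shift_nil.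
  rewrite big1 ?addr0 // => i; rewrite shift_cons -(inj_eq val_inj) /=.
  by move/negbTE => ->.
rewrite shift_cons -{}IHv; case: ifP => jk.
  by apply: eq_bigr => i _; rewrite /= shift_cons jk.
by rewrite big1 // => i _; rewrite /= shift_cons jk.
Qed.

Lemma inG_rotates x : inG x -> rotates x.
Proof.
move: x; apply: inG_ind.
- by move=> v i; rewrite label1 addr0.
- exact: rotatesM.
- exact: rotatesV.
- exact: rotates_shift.
- exact: rotates_shift.
Qed.

Lemma inG_balanced x : inG x -> balanced x.
Proof.
move=> Gx; suff: inG x /\ balanced x by case.
move: x Gx; apply: inG_ind => [|x y [Gx bx] [Gy bY]|x [Gx bx]||].
- split; first exact: inG1.
  by move=> v; rewrite label1 big1 // => i _; rewrite label1.
- split; first exact: inGM.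
  by apply: balancedM => //; exact: inG_rotates.
- by split; [exact: inGV | apply: balancedV => //; exact: inG_rotates].
- by split; [exact: inG_g | exact: balanced_shift].
- by split; [exact: inG_h | exact: balanced_shift].
Qed.

(** The exponent sum of h in the section x_j of x at j, modulo p, is half of
2 phi + l ^ 2 - l, where l is the root label of x_j and phi is the sum of
i times the label of x_j at i. Since l is the total exponent sum modulo p, the
weight 2 l - (2 phi + l ^ 2 - l) of x is twice the exponent sum of g in x_j. *)
Definition weight x j : I :=
  (3%:R * label x [:: j] - 2%:R * (\sum_i i * label x [:: j; i])
   - label x [:: j] ^+ 2)%R.

Lemma weight1 j : weight 1 j = 0%R.
Proof.
rewrite /weight label1 big1 => [|i _]; last by rewrite label1 mulr0.
by rewrite expr0n !mulr0 !subr0.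
Qed.

(** The sum of i times the label at i is not additive: composing with y shifts i
by the label of y, and by balancedness this costs the product of the labels of
the two sections. The square in [weight] compensates for that product. *)
Lemma weightM x y j : inG x -> inG y ->
  (weight (x * y)%g j = weight y j + weight x (j + label y [::]))%R.
Proof.
move=> Gx Gy; have [rx ry] := (inG_rotates Gx, inG_rotates Gy).
have yj : y [:: j] = [:: (j + label y [::])%R].
  by have := ry [::] j; rewrite treeAut_nil.
set k := (j + _)%R in yj *; rewrite /weight labelM // yj.
have -> : (\sum_i i * label (x * y)%g [:: j; i] =
   \sum_i i * label y [:: j; i] + \sum_i i * label x [:: k; i] -
   label y [:: j] * label x [:: k])%R.
  have <- := inG_balanced Gx [:: k].
  rewrite mulr_sumr -addrA -sumrB [X in (_ + X)%R](reindex_inj (addIr (label y [:: j]))).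
  rewrite -big_split; apply: eq_bigr => i _ /=.
  rewrite labelM //; have /= -> := ry [:: j] i; rewrite yj /=.
  by ring.
by ring.
Qed.

Lemma weightV x j : inG x -> (weight (x^-1)%g (j + label x [::]) = - weight x j)%R.
Proof.
move=> Gx; apply/eqP; rewrite -addr_eq0 addrC; apply/eqP.
by rewrite -weightM ?mulVg ?weight1 //; exact: inGV.
Qed.

Lemma label_G1 x : G1 x -> label x [::] = 0%R.
Proof.
elim=> {x} [|x y Gx Gy|x y Gx IHx Gy IHy|x Gx IHx].
- exact: label1.
- have [rx ry] := (inG_rotates Gx, inG_rotates Gy).
  have [rVx rVy] := (rotatesV rx, rotatesV ry).
  have rxy := rotatesM rx ry; have rVyxy := rotatesM rVy rxy.
  by rewrite commgEl conjgE !labelM // !labelV // !treeAut_nil; ring.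
- rewrite labelM; [|exact/inG_rotates/derived_inG..].
  by rewrite treeAut_nil IHx IHy addr0.
- by rewrite labelV ?treeAut_nil ?IHx ?oppr0 //; exact/inG_rotates/derived_inG.
Qed.

Lemma weightM1 x y j : G1 x -> G1 y ->
  (weight (x * y)%g j = weight y j + weight x j)%R.
Proof.
by move=> Gx Gy; rewrite weightM ?(label_G1 Gy) ?addr0 //; exact: derived_inG.
Qed.

Lemma weightV1 x j : G1 x -> (weight (x^-1)%g j = - weight x j)%R.
Proof.
by move=> Gx; rewrite -weightV ?(label_G1 Gx) ?addr0 //; exact: derived_inG.
Qed.

Lemma G2_G1 x : G2 x -> G1 x.
Proof.
elim=> {x} [|x y Gx Gy|x y _ + _|x _].
- exact: derived1.
- by apply: derivedR; exact: derived_inG.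
- exact: derivedM.
- exact: derivedV.
Qed.

(** Elements of G' fix the first level, so [weight] is additive on G'. *)
Lemma weight_G2 x : G2 x -> weight x =1 (fun=> 0%R).
Proof.
elim=> {x} [|x y Gx Gy|x y Gx IHx Gy IHy|x Gx IHx] j.
- exact: weight1.
- have [GVx GVy] := (derivedV Gx, derivedV Gy).
  have Gxy := derivedM Gx Gy; have GVyxy := derivedM GVy Gxy.
  by rewrite commgEl conjgE !weightM1 // !weightV1 //; ring.
- by rewrite weightM1 ?IHx ?IHy ?addr0 //; exact: G2_G1.
- by rewrite weightV1 ?IHx ?oppr0 //; exact: G2_G1.
Qed.

Lemma weight_g j : weight (g_ p) j = (if j == 0 then 2%:R else 0)%R.
Proof.
rewrite /weight shift_cons shift_nil -(inj_eq val_inj) /=.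
rewrite big1 => [|i _]; first by case: ifP => _; ring.
rewrite shift_cons; case: ifP => _; last by rewrite mulr0.
rewrite shift_cons; case: eqP => i0; last by rewrite mulr0.
by rewrite (_ : i = 0%R) ?mul0r //; apply: val_inj.
Qed.

Lemma weight_h j : weight (h_ p) j = 0%R.
Proof.
rewrite /weight shift_cons shift_nil; case: ifP => j1; last first.
  by rewrite big1 => [|i _]; [ring | rewrite shift_cons j1 mulr0].
rewrite (bigD1 (1%R : I)) //= big1 => [|i i1]; rewrite shift_cons j1 shift_cons.
  by rewrite shift_nil /=; ring.
by move: i1; rewrite -(inj_eq val_inj) /= => /negbTE->; rewrite mulr0.
Qed.

(** Below the root, [weight] of g is 2 at 0 only; hence the value here is 2 at -1,
-2 at 0 and 0 elsewhere. *)
Lemma weight_gh j : (weight [~ g_ p, h_ p] j =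
  weight (g_ p) (j + 1) - weight (g_ p) j)%R.
Proof.
have [Gg Gh] := (inG_g p, inG_h p); have [GVg GVh] := (inGV Gg, inGV Gh).
have Ggh := inGM Gg Gh; have GVgh := inGM GVh Ggh.
have [rg rh] := (@rotates_shift 0, @rotates_shift 1).
rewrite commgEl conjgE !weightM // !labelM ?treeAut_nil //; try exact: inG_rotates.
rewrite labelV // treeAut_nil !shift_nil.
have vg := weightV j Gg; have vh := weightV (j + 1)%R Gh.
rewrite !shift_nil weight_h in vg vh.
rewrite weight_h add0r !(addrA j) vh addrK vg.
by ring.
Qed.

Lemma weightR x y j : inG x -> G1 y ->
  (weight [~ y, x] j = weight y (j + label x [::]) - weight y j)%R.
Proof.
move=> Gx Gy; have Gy' := derived_inG Gy; have rx := inG_rotates Gx.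
have [GVx GVy] := (inGV Gx, inGV Gy').
have Gyx := inGM Gy' Gx; have GVyx := inGM GVx Gyx.
have ly : label (x^-1 * (y * x)) [::] = 0%R.
  rewrite labelM ?labelM ?labelV ?treeAut_nil //; try exact: inG_rotates.
  by rewrite (label_G1 Gy) addr0 subrr.
rewrite commgEl conjgE weightM // ly addr0 !weightM // (weightV1 _ Gy).
rewrite labelM ?treeAut_nil ?(label_G1 Gy) ?addr0 //; try exact: inG_rotates.
by rewrite weightV //; ring.
Qed.

Lemma label_gX n : label (g_ p ^+ n) [::] = n%:R%R.
Proof.
elim: n => [|n IHn]; first exact: label1.
have Gn : inG (g_ p ^+ n).
  elim: n {IHn} => [|n IHn]; first exact: inG1.
  by rewrite expgS; apply: inGM => //; exact: inG_g.
rewrite expgS labelM; [|exact: inG_rotates (inG_g _)|exact: inG_rotates].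
by rewrite IHn treeAut_nil shift_nil mulrSr.
Qed.

Lemma natr_eq0_dvd n : (n%:R = 0 :> I)%R -> p %| n.
Proof.
by rewrite Zp_nat => /(congr1 val) /= n0; apply/eqP.
Qed.

(** If n is nonzero modulo p, the weight at 0 is 2, or 4 when n = -1; neither
vanishes modulo an odd prime. *)
Lemma G2_dvd n : prime p -> G2 [~ [~ g_ p, h_ p], g_ p ^+ n] -> p %| n.
Proof.
move=> p_prime G2c; have Gg := inG_g p; have Gh := inG_h p.
have Gn : inG (g_ p ^+ n).
  elim: n {G2c} => [|n IHn]; first exact: inG1.
  by rewrite expgS; exact: inGM.
have := weight_G2 G2c 0%R.
rewrite weightR //; last exact: derivedR.
rewrite label_gX !weight_gh !add0r !weight_g eqxx oner_eq0.
have [/natr_eq0_dvd//|n0] := eqVneq (n%:R%R : I) 0%R.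
have no_pow2 k : (2 ^ k)%:R%R <> 0%R :> I.
  by move/natr_eq0_dvd; rewrite Euclid_dvdX // dvdn_prime2.
case: ifP => _ E.
  by case: (no_pow2 2); rewrite -[RHS]E; ring.
by case: (no_pow2 1%N); rewrite -[RHS]E; ring.
Qed.

End Labels.

(** * The invariant *)

Lemma commutator_pow_second_derived q (x y : G_ q) : 5 <= q -> derived (fun=> True) y ->
  second_derived [~ y, x ^+ q].
Proof.
case: q x y => [|[|[|[|[|m]]]]] // x y _ Dy.
pose v := @group_morph (G_ m.+2.+3) (treeAut m.+2.+3) val (@gmulfM _ _ _).
have Dv z : derived (fun=> True) z -> derived (@inG m.+2.+3) (v z).
  by apply: derived_morph => t _; exact: (valP t).
have [z Dz] : exists2 z, second_derived z & v z = v [~ y, x ^+ m.+2.+3].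
  apply: (derived_lift (Q := derived (@inG m.+2.+3))).
    apply: derived_lift => t Gt; by exists (exist _ t Gt).
  rewrite gmulfR gmulfXn; apply: commutator_pow_G2 => //; last exact: Dv.
    by move=> i t; exact: derived_realizes.
  exact: (valP x).
by move/val_inj <-.
Qed.

Lemma dvd_of_commutator_pow p (p_prime : prime p) n : 3 <= p ->
  (forall x y : G_ p, derived (fun=> True) y -> second_derived [~ y, x ^+ n]) ->
  p %| n.
Proof.
case: p p_prime => [|[|[|m]]] // p_prime _ H.
pose v := @group_morph (G_ m.+3) (treeAut m.+3) val (@gmulfM _ _ _).
pose g : G_ m.+3 := exist _ (g_ m.+3) (inG_g _).
pose h : G_ m.+3 := exist _ (h_ m.+3) (inG_h _).
apply: G2_dvd => //.
have -> : [~ [~ g_ m.+3, h_ m.+3], g_ m.+3 ^+ n] = v [~ [~ g, h], g ^+ n].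
  by rewrite 2!gmulfR gmulfXn.
have : second_derived [~ [~ g, h], g ^+ n] by apply: H; exact: derivedR.
apply: derived_morph => z; apply: derived_morph => t _; exact: (valP t).
Qed.

Lemma isomorphic_sym (G H : groupType) : isomorphic G H -> isomorphic H G.
Proof.
case=> f [f' fK f'K].
have f'M : {morph f' : x y / x * y} := can2_gmulfM fK f'K.
pose F : {multiplicative H -> G} := HB.pack f' (isMultiplicative.Build H G f' f'M).
by exists F; exists f.
Qed.

Lemma isomorphic_dvd (p q : nat) : prime p -> 3 <= p -> 5 <= q ->
  isomorphic (G_ p) (G_ q) -> p %| q.
Proof.
move=> p_prime p3 q5 [f [f' fK f'K]]; apply: dvd_of_commutator_pow => // x y Dy.
pose F := group_morph (@gmulfM _ _ f).
pose F' := group_morph (can2_gmulfM fK f'K).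
have -> : [~ y, x ^+ q] = F' [~ F y, F x ^+ q].
  by rewrite gmulfR gmulfXn /= !fK.
apply: (derived_morph (f := F')); last first.
  by apply: commutator_pow_second_derived => //; exact: derived_morph Dy.
by move=> z; exact: derived_morph.
Qed.

Theorem theorem9p4 (p q : nat) (p_prime : prime p) (q_prime : prime q)
    (p_ge3 : 3 <= p) (q_ge3 : 3 <= q) (p_neq_q : p <> q) :
  ~ isomorphic (G_ p) (G_ q).
Proof.
wlog q5 : p q p_prime q_prime p_ge3 q_ge3 p_neq_q / 5 <= q.
  move=> H; have [|q5] := leqP 5 q; first exact: H.
  move=> /isomorphic_sym; apply: H => //; first by move/esym.
  case: p q p_prime q_prime p_ge3 q_ge3 p_neq_q q5.
    by [].
  by move=> [|[|[|[|p]]]] [|[|[|[|[|q]]]]].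
move/(isomorphic_dvd p_prime p_ge3 q5); rewrite dvdn_prime2 //.
by move/eqP.
Qed.
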